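(* Let $G=\prod_{i=1}^n H_i$, where each $H_i$ is a complete multipartite graph. If $S\subseteq V(G)$ is an irredundant set, then there exist sets $L,T\subseteq S$ with $L\cap T=\emptyset$, $L\cup T=S$, $L$ an independent set in $G$, and $|T|\leq 2^n$. (Here $L$ can be taken to be the set of vertices of $S$ having no neighbor in $S$, and $T=S\setminus L$.) In particular, $\mathrm{IR}(G)\leq \alpha(G)+2^n$.
   Context: All graphs are simple. The direct product $\prod_{i=1}^n H_i$ has vertex set $V(H_1)\times\cdots\times V(H_n)$, with $(g_1,\ldots,g_n)$ adjacent to $(g_1',\ldots,g_n')$ iff $g_i$ is adjacent to $g_i'$ in $H_i$ for every $i$. For $S\subseteq V(G)$, $N[S]$ is the union of $S$ with all neighbors of vertices in $S$; $S$ is irredundant if $N[S\setminus\{v\}]\neq N[S]$ for all $v\in S$. $\alpha(G)$ is the independence number and $\mathrm{IR}(G)$ is the maximum size of an irredundant set in $G$. *)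

(* Defs.v *)
From HB Require Import structures.
From mathcomp Require Import all_boot.

Set Implicit Arguments.
Unset Strict Implicit.
Unset Printing Implicit Defensive.

Record sgraph := SGraph {
  vertex :> finType;
  edge : rel vertex;
  edge_sym : symmetric edge;
  edge_irr : irreflexive edge
}.

(* Any number of parts is allowed; the parts of [partition] are nonempty. *)
Definition complete_multipartite (G : sgraph) : Prop :=
  exists P : {set {set G}}, partition P [set: G] /\
    forall x y : G, edge x y = (pblock P x != pblock P y).

Section DirectProduct.

Variables (n : nat) (H : 'I_n -> sgraph).

Definition dprod_vertex : finType := {dffun forall i : 'I_n, vertex (H i)}.

Definition dprod_edge : rel dprod_vertex :=
  fun g g' => [forall i, edge (g i) (g' i)].

Lemma dprod_edge_sym : symmetric dprod_edge.
Proof. by move=> g g'; apply: eq_forallb => i; rewrite edge_sym. Qed.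

Lemma dprod_edge_irr : 0 < n -> irreflexive dprod_edge.
Proof.
by move=> n_gt0 g; apply/forallP => /(_ (Ordinal n_gt0)); rewrite edge_irr.
Qed.

(* The empty product would be a single vertex with a loop, hence [0 < n]. *)
Definition direct_product (n_gt0 : 0 < n) : sgraph :=
  SGraph dprod_edge_sym (dprod_edge_irr n_gt0).

End DirectProduct.

Section Irredundance.

Variable G : sgraph.
Implicit Type S : {set G}.

Definition closed_nbhd S : {set G} :=
  S :|: [set y | [exists x in S, edge x y]].

Definition irredundant S : bool :=
  [forall v in S, closed_nbhd (S :\ v) != closed_nbhd S].

Definition independent S : bool :=
  [forall x in S, forall y in S, ~~ edge x y].

Definition isolated_in S : {set G} :=
  [set v in S | ~~ [exists u in S, edge v u]].

Definition independence_number : nat := \max_(S | independent S) #|S|.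

Definition upper_irredundance_number : nat := \max_(S | irredundant S) #|S|.

End Irredundance.

(* Main.v *)
Require Import Defs.
From HB Require Import structures.
From mathcomp Require Import all_boot all_algebra.

Set Implicit Arguments.
Unset Strict Implicit.
Unset Printing Implicit Defensive.

(** Every non-isolated vertex [v] of an irredundant set [S] has a private
    neighbour [w v] outside [S].  Labelling the parts of each factor by distinct
    rationals, the matrix with entries [\prod_k (label (v k) - label (w u k))],
    for non-isolated [v] and [u], is diagonal with nonzero diagonal entries;
    expanding the product over the [n] coordinates shows that its rank is at
    most [2 ^ n]. *)

Lemma card_diagonal_product (F : fieldType) (n : nat) (I : finType)
    (a b : I -> 'I_n -> F) :
  (forall s k, a s k != b s k) ->
  (forall s t, s != t -> exists k, a s k = b t k) ->
  #|I| <= 2 ^ n.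
Proof.
move=> ab_neq ab_eq; pose J := {ffun 'I_n -> bool}.
(* A function in [J] records, for each coordinate, which term of the binomial [a s k - b t k] is
   picked; [A] collects the factors depending on [s], [B] those depending on [t]. *)
pose A := (\matrix_(i < #|I|, j < #|J|) \prod_k
  if enum_val j k then a (enum_val i) k else 1)%R.
pose B := (\matrix_(j < #|J|, i < #|I|) \prod_k
  if enum_val j k then 1 else - b (enum_val i) k)%R.
pose d := (\row_(i < #|I|) \prod_k (a (enum_val i) k - b (enum_val i) k))%R.
have AB : (A *m B = diag_mx d)%R.
  apply/matrixP => i j; rewrite !mxE.
  under [LHS]eq_bigr => l _ do rewrite !mxE -big_split /=.
  (* Reindexed over [J], the sum over all choices refolds by distributivity into a product of
     binomials. *)
  rewrite -(big_enum_val (fun f : J => \prod_k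
    ((if f k then a (enum_val i) k else 1) *
     (if f k then 1 else - b (enum_val j) k)))%R) /=.
  rewrite -(bigA_distr_bigA (fun k c =>
    (if c then a (enum_val i) k else 1) *
    (if c then 1 else - b (enum_val j) k)))%R /=.
  under [LHS]eq_bigr => k _ do rewrite big_bool /= GRing.mulr1 GRing.mul1r.
  have [<-|neq_ij] := eqVneq i j; first by rewrite GRing.mulr1n.
  have [|k abk] := ab_eq (enum_val i) (enum_val j).
    by rewrite (inj_eq enum_val_inj).
  by rewrite GRing.mulr0n (bigD1 k) //= abk GRing.subrr GRing.mul0r.
have d_unit : diag_mx d \in unitmx.
  rewrite unitmxE det_diag GRing.unitfE; apply/GRing.prodf_neq0 => i _.
  by rewrite mxE; apply/GRing.prodf_neq0 => k _; rewrite GRing.subr_eq0.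
(* The invertible diagonal matrix has rank [#|I|], while [B] has only [#|J|] rows. *)
rewrite -(mxrank_unit d_unit) -AB.
apply: leq_trans (mxrankM_maxr _ _) (leq_trans (rank_leq_row _) _).
by rewrite card_ffun card_bool card_ord.
Qed.

(** Each part is numbered, and characteristic zero keeps the numbers distinct in the field, so one
    field serves factors with any number of parts. *)
Lemma complete_multipartite_label (G : sgraph) : complete_multipartite G ->
  exists c : {ffun G -> rat}, forall x y : G, edge x y = (c x != c y).
Proof.
case=> P [_ edgeP].
exists [ffun x => (enum_rank (pblock P x) : nat)%:R%R] => x y.
rewrite edgeP !ffunE Num.Theory.eqr_nat; congr (~~ _).
by rewrite (inj_eq val_inj) (inj_eq enum_rank_inj).
Qed.

Lemma irredundant_private_neighbor (G : sgraph) (S : {set G}) v :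
  irredundant S -> v \in S :\: isolated_in S ->
  exists w, edge v w /\ forall u, u \in S -> u != v -> ~~ edge u w.
Proof.
move=> /forall_inP irrS; rewrite !inE => /andP[+ vS].
rewrite vS /= negbK => /exists_inP[u uS vu].
have /eqP nbhd_neq := irrS _ vS.
have [w] : exists w, (w \in closed_nbhd S) && (w \notin closed_nbhd (S :\ v)).
  (* Closed neighbourhoods are monotone, so if deleting [v] lost no vertex, the two would
     coincide. *)
  apply/existsP; apply: contra_notT nbhd_neq => /existsPn nbhdP.
  apply/eqP; rewrite eqEsubset; apply/andP; split; apply/subsetP => x.
    rewrite !inE => /orP[/andP[_ ->] //|/exists_inP[y]].
    rewrite !inE => /andP[_ yS] yx.
    by apply/orP; right; apply/exists_inP; exists y.
  by move=> xS; have := nbhdP x; rewrite xS /= negbK.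
rewrite !inE negb_or => /andP[wN /andP[w_notin /exists_inPn w_priv]].
have priv y : y \in S -> y != v -> ~~ edge y w.
  by move=> yS yv; apply: w_priv; rewrite !inE yv.
exists w; split=> //.
(* The lost vertex cannot be [v] itself, which its neighbour [u] still dominates. Hence [w] lies
   outside [S], and only [v] can dominate it. *)
have [wv|wv] := eqVneq w v.
  have uv : u != v by apply: contraTneq vu => ->; rewrite edge_irr.
  by have := priv u uS uv; rewrite wv edge_sym vu.
move: w_notin wN; rewrite wv /= => /negPf-> /= /exists_inP[y yS yw].
have [<- //|yv] := eqVneq y v.
by have := priv y yS yv; rewrite yw.
Qed.

Lemma card_nonisolated_irredundant (n : nat) (n_gt0 : 0 < n)
    (H : 'I_n -> sgraph) (S : {set direct_product H n_gt0}) :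
  (forall i, complete_multipartite (H i)) -> irredundant S ->
  #|S :\: isolated_in S| <= 2 ^ n.
Proof.
move=> Hmulti irrS; set T := S :\: _.
have [c cP] := fin_all_exists (fun i => complete_multipartite_label (Hmulti i)).
have [w wP] := fin_all_exists
  (fun v : {v | v \in T} => irredundant_private_neighbor irrS (valP v)).
rewrite -card_sig.
(* Adjacency in the product means differing labels in every coordinate, so a non-adjacent pair
   agrees in some coordinate. *)
apply: (card_diagonal_product (a := fun (v : {v | v \in T}) k => c k (val v k))
  (b := fun v k => c k (w v k))) => [v k | u v uv].
  by have [/forallP/(_ k)] := wP v; rewrite cP.
have uS : val u \in S by have := valP u; rewrite inE => /andP[].
have [_ /(_ _ uS)] := wP v.
rewrite (inj_eq val_inj) => /(_ uv)/forallPn[k].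
by rewrite cP negbK => /eqP; exists k.
Qed.

Lemma isolated_in_sub (G : sgraph) (S : {set G}) : isolated_in S \subset S.
Proof. by apply/subsetP => x; rewrite inE => /andP[]. Qed.

Lemma independent_isolated_in (G : sgraph) (S : {set G}) :
  independent (isolated_in S).
Proof.
apply/forall_inP => x; rewrite inE => /andP[_ /exists_inPn xN].
by apply/forall_inP => y /(subsetP (isolated_in_sub S)); apply: xN.
Qed.

Theorem theorem1p4 (n : nat) (n_gt0 : 0 < n) (H : 'I_n -> sgraph)
    (Hmulti : forall i : 'I_n, complete_multipartite (H i)) :
  let G := direct_product H n_gt0 in
  (forall S : {set G}, irredundant S ->
     exists L T : {set G},
       (L \subset S /\ T \subset S /\
        L :&: T = set0 /\ L :|: T = S /\
        independent L /\ #|T| <= 2 ^ n) /\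
       (L = isolated_in S /\ T = S :\: L)) /\
  upper_irredundance_number G <= independence_number G + 2 ^ n.
Proof.
move=> G; split=> [S irrS|].
  exists (isolated_in S), (S :\: isolated_in S); do !split=> //.
  - exact: isolated_in_sub.
  - exact: subsetDl.
  - by rewrite setIDA [_ :&: S]setIC -setIDA setDv setI0.
  - by rewrite -{1}(setIidPr (isolated_in_sub S)) setID.
  - exact: independent_isolated_in.
  - exact: card_nonisolated_irredundant.
apply/bigmax_leqP => S irrS.
rewrite -(cardsID (isolated_in S) S) (setIidPr (isolated_in_sub S)).
apply: leq_add; last exact: card_nonisolated_irredundant.
exact: (bigmax_sup (isolated_in S)) (independent_isolated_in S) (leqnn _).
Qed.
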